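(* Let $r\ge1$ and $n\ge1$ be integers and let $m,\ell\ge 0$ be integers. The number of involutions $\pi\in G_{r,n}$ with exactly $m$ absolute fixed points and $\mathrm{exc}_A(\pi)=\ell$ is $$\left(\frac{n-m}{2}\right)!\,(r-1)^{\frac{n-m}{2}-\ell}\binom{n}{\frac{n-m}{2},\ m,\ \frac{n-m}{2}-\ell,\ \ell}\,2^{\frac{m(3-2k)-n}{2}},$$ where $k\in\{0,1\}$ and $k\equiv r \pmod 2$.
   Context: Let $\Sigma=\{i^{[c]} : 1\le i\le n,\ c\in\mathbb{Z}_r\}$ be the set $[n]=\{1,\dots,n\}$ coloured with colours $0,1,\dots,r-1$; write $i$ for $i^{[0]}$. The group $G_{r,n}=\mathbb{Z}_r\wr S_n$ of coloured permutations consists, under composition, of all bijections $\sigma:\Sigma\to\Sigma$ for which there are a permutation $|\sigma|\in S_n$ and integers $z_1(\sigma),\dots,z_n(\sigma)\in\{0,\dots,r-1\}$ with $\sigma(i^{[c]})=(|\sigma|(i))^{[c+z_i(\sigma)]}$ (colours added modulo $r$). An element $\pi$ is an involution if $\pi^2=1$ (the identity included). An absolute fixed point of $\sigma$ is an $i\in[n]$ with $|\sigma|(i)=i$. The colour order on $\Sigma$ is $1^{[r-1]}<\cdots<n^{[r-1]}<1^{[r-2]}<\cdots<n^{[r-2]}<\cdots<1<\cdots<n$. Define $\mathrm{exc}_A(\sigma)=|\{i\in[n-1] : \sigma(i)>i\}|$ (comparison in the colour order). A multinomial coefficient $\binom{n}{a_1,\dots,a_s}=\frac{n!}{a_1!\cdots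 a_s!}$ (with $a_1+\dots+a_s=n$) is $0$ if some $a_i$ is not a nonnegative integer, and any product containing such a vanishing coefficient is understood to be $0$. Also $0^0=1$. *)

(* Defs.v *)
From HB Require Import structures.
From mathcomp Require Import all_boot all_order all_algebra all_fingroup.

Set Implicit Arguments.
Unset Strict Implicit.
Unset Printing Implicit Defensive.

Import Order.TTheory GRing.Theory Num.Theory.
Local Open Scope ring_scope.

(* The additive group Z_r for r >= 1; the library's 'Z_r is Z_2 when r = 1. *)
Notation colour r := ('I_r.-1.+1).

Lemma val_colourD (r : nat) (c d : colour r) :
  (0 < r)%N -> val (c + d) = ((c + d) %% r)%N.
Proof. by case: r c d. Qed.

(* (i, c) stands for i^[c]; the points 1, ..., n are 0, ..., n - 1 here. *)
Notation Sigma r n := ('I_n * colour r)%type.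

Definition G (r n : nat) : {set {perm Sigma r n}} :=
  [set sigma : {perm Sigma r n} | [exists s : 'S_n, exists z : {ffun 'I_n -> colour r},
    forall i : 'I_n, forall c : colour r,
      sigma (i, c) == (s i, c + z i)]].

Definition uncoloured (r n : nat) (i : 'I_n) : Sigma r n := (i, 0).

(* |sigma|(i), see absE. *)
Definition abs (r n : nat) (sigma : {perm Sigma r n}) (i : 'I_n) : 'I_n :=
  (sigma (uncoloured r i)).1.

Lemma absE (r n : nat) (sigma : {perm Sigma r n}) (s : 'S_n)
    (z : 'I_n -> colour r) :
  (forall i c, sigma (i, c) = (s i, c + z i)) -> abs sigma =1 s.
Proof. by move=> sigmaE i; rewrite /abs sigmaE. Qed.

Definition involutive_perm (r n : nat) (sigma : {perm Sigma r n}) : bool :=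
  (sigma ^+ 2 == 1)%g.

Definition absfix (r n : nat) (sigma : {perm Sigma r n}) : {set 'I_n} :=
  [set i | abs sigma i == i].

(* The colour order: larger colours come first. *)
Definition colour_lt (r n : nat) (x y : Sigma r n) : bool :=
  (y.2 < x.2)%N || (x.2 == y.2) && (x.1 < y.1)%N.

Definition excA (r n : nat) (sigma : {perm Sigma r n}) : nat :=
  #|[set i : 'I_n | (i.+1 < n)%N &
      colour_lt (uncoloured r i) (sigma (uncoloured r i))]|.

(* Meant for a with sum n; the entries are rational so that the convention on
   entries that are not natural numbers can be expressed. *)
Definition multinomial (n : nat) (a : seq rat) : rat :=
  if all (fun x => x \is a Num.nat) a
  then n`!%:R / \prod_(x <- a) (Num.truncn x)`!%:R
  else 0.

(* Main.v *)
(* A coloured involution is determined by the images f i = (|sigma| i, z_i) of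
   the uncoloured points, and such an f comes from an involution iff
   f (f i).1 = (i, - z_i).  Such f supported on a set S are counted by induction
   on #|S|: the image (y, c) of a chosen x in S is either (x, c) with 2c = 0, or
   y != x, and then the pair {x, y} is an absolute 2-cycle that contributes one
   excedance iff c = 0.  Removing x and y leaves the same problem on
   S \ {x, y}. *)
Require Import Defs.
From HB Require Import structures.
From mathcomp Require Import all_boot all_order all_algebra all_fingroup.
From mathcomp Require Import ring zify.

Set Implicit Arguments.
Unset Strict Implicit.
Unset Printing Implicit Defensive.

Import Order.TTheory GRing.Theory Num.Theory.
Local Open Scope ring_scope.

(** * Involutions coloured by a finite abelian group, with support in a set S *)

Section ColouredInvolutions.

Variables (n : nat) (V : finZmodType).
Implicit Types (S : {set 'I_n}) (f g : {ffun 'I_n -> 'I_n * V}).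

(** Off S the function is the identity, so every stage of the induction on S lives in one type of
    functions on ['I_n]. *)
Definition colinv S f : bool :=
  [forall i, f (f i).1 == (i, - (f i).2)] &&
  [forall i, (i \notin S) ==> (f i == (i, 0))].

Definition fixedin S f : nat := #|[set i in S | (f i).1 == i]|.

(** Colour 0 is the top block of the colour order, so an uncoloured point can only be exceeded by
    another uncoloured point. *)
Definition exc f : nat := #|[set i : 'I_n | (i < (f i).1)%N & (f i).2 == 0]|.

Definition colinvs S (m l : nat) : {set {ffun 'I_n -> 'I_n * V}} :=
  [set f | [&& colinv S f, fixedin S f == m & exc f == l]].

Lemma colinvP S f :
  reflect ((forall i, f (f i).1 = (i, - (f i).2)) /\
           (forall i, i \notin S -> f i = (i, 0)))
          (colinv S f).
Proof.
apply: (iffP andP) => -[fK fS]; split.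
- by move=> i; apply/eqP/(forallP fK).
- by move=> i iS; apply/eqP; move/forallP: fS => /(_ i) /implyP; apply.
- by apply/forallP => i; apply/eqP.
- by apply/forallP => i; apply/implyP => iS; apply/eqP/fS.
Qed.

Lemma colinv_stable S f i : colinv S f -> i \in S -> (f i).1 \in S.
Proof.
move=> /colinvP[fK fS] iS; apply: contraT => jS.
by have := fK i; rewrite (fS _ jS) => -[E _]; rewrite E iS in jS.
Qed.

(** S splits into fixed points, points moved up and points moved down. The first component of f maps
    the points moved up bijectively onto those moved down, so there are equally many of each. *)
Lemma card_colinv S f :
  colinv S f -> exists d, #|S| = (fixedin S f + (exc f + d).*2)%N.
Proof.
move=> fS; have [fK fO] := colinvP _ _ fS.
pose up := [set i : 'I_n | (i < (f i).1)%N].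
pose down := [set i : 'I_n | ((f i).1 < i)%N].
have fst_inj : injective (fun i => (f i).1).
  by move=> i j E; have := fK i; rewrite E fK => -[].
have downE : down = [set (f i).1 | i in up].
  apply/setP => j; rewrite inE; apply/idP/imsetP => [lt|[i]].
    by exists (f j).1; rewrite ?inE fK.
  by rewrite inE => lt ->; rewrite fK.
have cud : #|down| = #|up| by rewrite downE card_imset.
have offS i : i \notin S -> (f i).1 = i by move=> /fO ->.
have sup : up \subset S.
  by apply/subsetP => i; rewrite inE; apply: contraTT => /offS ->; rewrite ltnn.
have sdown : down \subset S.
  by apply/subsetP => i; rewrite inE; apply: contraTT => /offS ->; rewrite ltnn.
have dis : up :&: down = set0.
  by apply/setP => i; rewrite !inE; case: ltngtP.
have SE : S = [set i in S | (f i).1 == i] :|: (up :|: down).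
  apply/setP => i; rewrite !inE; case: (boolP (i \in S)) => iS /=.
    by rewrite -(inj_eq val_inj) /=; case: ltngtP.
  by rewrite (offS _ iS) ltnn.
(* The witness d is the number of 2-cycles that are not excedances. *)
exists #|[set i : 'I_n | (i < (f i).1)%N & (f i).2 != 0]|.
have -> : (exc f + #|[set i : 'I_n | (i < (f i).1)%N & (f i).2 != 0%R]|
           = #|up|)%N.
  rewrite -(cardsID [set i | (f i).2 == 0] up) /exc.
  by congr (_ + _)%N; apply: eq_card => i; rewrite !inE // andbC.
rewrite {1}SE cardsU cardsU dis cards0 subn0 cud addnn.
rewrite (_ : _ :&: (up :|: down) = set0) ?cards0 ?subn0 //.
apply/setP => i; rewrite !inE -(inj_eq val_inj) /=.
by case: ltngtP; rewrite ?andbF ?andbT.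
Qed.

(** * Adding one cycle through x *)

Definition extend x y c g : {ffun 'I_n -> 'I_n * V} :=
  [ffun i => if i == x then (y, c) else if i == y then (x, - c) else g i].

Section Extend.

Variables (S : {set 'I_n}) (x y : 'I_n) (c : V).
(** The case y = x, a fixed point, is treated together with the 2-cycles: then D is S without x, and
    c must be its own inverse. *)
Hypotheses (xS : x \in S) (yS : y \in S) (cN : y = x -> - c = c).

Let D := S :\: [set x; y].

(** Being involutive, f sends y back to x with colour -c, so no other point is sent to x or y, and
    the restriction of f to D stays involutive. *)
Lemma extend_fix f : colinv S f -> f x = (y, c) ->
  exists2 g, colinv D g & f = extend x y c g.
Proof.
move=> fS fx; have [fK fO] := colinvP _ _ fS.
have fy : f y = (x, - c) by have := fK x; rewrite fx.
exists [ffun i => if i \in D then f i else (i, 0)].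
  apply/colinvP; split=> i; rewrite !ffunE; last by move/negPf ->.
  case: (boolP (i \in D)) => iD /=; last by rewrite (negPf iD) oppr0.
  have -> : (f i).1 \in D.
    move: iD; rewrite !inE !negb_or => /andP[/andP[ix iy] iS].
    rewrite (colinv_stable fS iS) andbT; apply/andP; split.
      by apply: contra iy => /eqP E; have := fK i; rewrite E fx => -[->].
    by apply: contra ix => /eqP E; have := fK i; rewrite E fy => -[->].
  exact: fK.
apply/ffunP => i; rewrite !ffunE.
case: eqP => [->//|ix]; case: eqP => [->//|iy].
by rewrite !inE; case: eqP => // _; case: eqP => //= _; case: ifP => // /negbT/fO.
Qed.

Lemma colinv_extend g : colinv D g -> colinv S (extend x y c g).
Proof.
move=> gD; have [gK gO] := colinvP _ _ gD.
have gx : g x = (x, 0) by apply: gO; rewrite !inE eqxx.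
have gy : g y = (y, 0) by apply: gO; rewrite !inE eqxx orbT.
have neqs i z : g z = (z, 0) -> i != z -> (g i).1 != z.
  by move=> gz; apply: contra => /eqP E; have := gK i; rewrite E gz => -[->].
apply/colinvP; split=> i; rewrite !ffunE.
  case: (eqVneq i x) => [->|ix] /=.
    by case: eqVneq => [yx|yx]; rewrite ?eqxx //= {1}yx cN.
  case: (eqVneq i y) => [->|iy] /=; first by rewrite eqxx opprK.
  by rewrite (negPf (neqs _ _ gx ix)) (negPf (neqs _ _ gy iy)) gK.
move=> iS; case: eqP => [E|_]; first by rewrite E xS in iS.
case: eqP => [E|_]; first by rewrite E yS in iS.
by apply: gO; rewrite !inE (negPf iS) andbF.
Qed.

(** The values overwritten at x and y carry no information, since every g on D is trivial there. *)
Lemma extend_inj : {in [set g | colinv D g] &, injective (extend x y c)}.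
Proof.
move=> g h; rewrite !inE => /colinvP[_ gO] /colinvP[_ hO] /ffunP E.
apply/ffunP => i; have := E i; rewrite !ffunE.
case: eqP => [-> _|ix]; first by rewrite gO ?hO // !inE eqxx.
by case: eqP => [-> _|//]; rewrite gO ?hO // !inE eqxx orbT.
Qed.

Lemma fixedin_extend g : colinv D g ->
  fixedin S (extend x y c g) = ((y == x) + fixedin D g)%N.
Proof.
move=> gD; rewrite /fixedin; case: eqVneq => [yx|yx].
  have := cardsU1 x [set i in D | (g i).1 == i].
  rewrite [x \in _]inE in_setD !inE eqxx => <-.
  apply: eq_card => i; rewrite !inE !ffunE yx.
  by case: (eqVneq i x) => [->|ix] //=; rewrite ?xS ?eqxx.
rewrite add0n; apply: eq_card => i; rewrite !inE !ffunE.
case: (eqVneq i x) => [->|ix] /=; first by rewrite (negPf yx) andbF.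
by case: (eqVneq i y) => [->|iy] //=; rewrite eq_sym (negPf yx) andbF.
Qed.

(** The colours c and -c of the new cycle vanish together. If they do and y differs from x, exactly
    the smaller of x and y becomes an excedance. *)
Lemma exc_extend g : colinv D g ->
  exc (extend x y c g) = ((y != x) && (c == 0%R) + exc g)%N.
Proof.
move=> /colinvP[_ gO]; rewrite /exc.
have gx : g x = (x, 0) by apply: gO; rewrite !inE eqxx.
have gy : g y = (y, 0) by apply: gO; rewrite !inE eqxx orbT.
case: (boolP ((y != x) && (c == 0))) => [/andP[yx /eqP c0]|H].
  pose z := if (x < y)%N then x else y.
  have gz : g z = (z, 0) by rewrite /z; case: ifP.
  have := cardsU1 z [set i : 'I_n | (i < (g i).1)%N & (g i).2 == 0].
  rewrite [z \in _]inE gz ltnn => <-.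
  apply: eq_card => i; rewrite !inE !ffunE c0 oppr0 /z.
  move: yx; rewrite -(inj_eq val_inj) /=.
  case: (eqVneq i x) => [->|ix] /=.
    case: (ltngtP x y) => //= xy _; rewrite ?eqxx // gx ltnn orbF.
    by rewrite -(inj_eq val_inj) /= gtn_eqF.
  case: (eqVneq i y) => [->|iy] /=.
    case: (ltngtP x y) => //= xy _; rewrite ?eqxx // gy ltnn orbF.
    by rewrite -(inj_eq val_inj) /= gtn_eqF.
  by case: ifP; rewrite ?(negPf ix) ?(negPf iy).
rewrite add0n; apply: eq_card => i; rewrite !inE !ffunE.
case: (eqVneq i x) => [->|ix] /=.
  rewrite gx ltnn; apply/negP => /andP[lt c0].
  by move: H; rewrite c0 andbT negbK => /eqP E; rewrite E ltnn in lt.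
case: (eqVneq i y) => [->|iy] //=; rewrite gy ltnn.
apply/negP => /andP[lt c0].
by move: H; rewrite -oppr_eq0 c0 andbT negbK => /eqP E; rewrite E ltnn in lt.
Qed.

(** The bijection behind the recursion. The statistics of g appear in sums equal to m and l, which
    avoids truncated subtraction. *)
Lemma card_colinvs_at m l :
  #|[set f in colinvs S m l | f x == (y, c)]| =
  #|[set g | [&& colinv D g, (y == x) + fixedin D g == m
              & ((y != x) && (c == 0%R)) + exc g == l]%N]|.
Proof.
rewrite -(card_in_imset (f := extend x y c)); last first.
  move=> g h; rewrite !inE => /and3P[gD _ _] /and3P[hD _ _].
  by apply: extend_inj; rewrite inE.
apply: eq_card => f; rewrite !inE; apply/idP/imsetP.
  move=> /andP[/and3P[fS fm fl] /eqP fx].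
  have [g gD E] := extend_fix fS fx; exists g => //.
  by rewrite inE gD -fixedin_extend // -exc_extend // -E fm.
move=> [g]; rewrite inE => /and3P[gD gm gl] ->.
by rewrite colinv_extend // fixedin_extend // exc_extend // gm gl ffunE !eqxx.
Qed.

End Extend.

(** * Recursion on S and its solution *)

Lemma colinvs_eq0 S m l :
  (forall d, #|S| != (m + (l + d).*2)%N) -> colinvs S m l = set0.
Proof.
move=> H; apply/setP => f; rewrite !inE; apply/negP => /and3P[fS /eqP fm /eqP fl].
by have [d E] := card_colinv fS; case/eqP: (H d); rewrite E fm fl.
Qed.

Lemma colinvs_set0 : colinvs set0 0 0 = [set [ffun i => (i, 0)]].
Proof.
apply/setP => f; rewrite !inE; apply/idP/eqP => [/and3P[/colinvP[_ fO] _ _]|->].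
  by apply/ffunP => i; rewrite ffunE fO ?inE.
apply/and3P; split.
- by apply/colinvP; split=> i; rewrite !ffunE ?oppr0.
- by rewrite cards_eq0; apply/eqP/setP => i; rewrite !inE.
- by rewrite cards_eq0; apply/eqP/setP => i; rewrite !inE ffunE ltnn.
Qed.

Lemma card_colinvs_fix S x c m l : x \in S -> - c = c ->
  #|[set f in colinvs S m l | f x == (x, c)]| =
  if m is m'.+1 then #|colinvs (S :\ x) m' l| else 0%N.
Proof.
move=> xS cN; rewrite (card_colinvs_at xS xS) // setUid eqxx /=.
case: m => [|m].
  by apply/eqP; rewrite cards_eq0; apply/eqP/setP => g; rewrite !inE andbF.
by apply: eq_card => g; rewrite !inE eqSS.
Qed.

Lemma card_colinvs_exc S x y m l : x \in S -> y \in S -> y != x ->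
  #|[set f in colinvs S m l | f x == (y, 0)]| =
  if l is l'.+1 then #|colinvs (S :\: [set x; y]) m l'| else 0%N.
Proof.
move=> xS yS yx; rewrite (card_colinvs_at xS yS) ?oppr0 //.
rewrite (negPf yx) eqxx /=; case: l => [|l].
  by apply/eqP; rewrite cards_eq0; apply/eqP/setP => g; rewrite !inE !andbF.
by apply: eq_card => g; rewrite !inE add0n eqSS.
Qed.

Lemma card_colinvs_nexc S x y c m l : x \in S -> y \in S -> y != x -> c != 0 ->
  #|[set f in colinvs S m l | f x == (y, c)]| =
  #|colinvs (S :\: [set x; y]) m l|.
Proof.
move=> xS yS yx c0; rewrite (card_colinvs_at xS yS) => [|/eqP]; last first.
  by rewrite (negPf yx).
by rewrite (negPf yx) (negPf c0); apply: eq_card => g; rewrite !inE.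
Qed.

(** t counts the possible colours of a fixed point, q those of a 2-cycle that is not an
    excedance. *)
Let t := #|[set c : V | - c == c]|.
Let q := #|V|.-1.

(** Sorting by the image of x; images outside S, or equal to x with a colour that is not
    self-inverse, do not occur. *)
Lemma sum_colinvs S x m l : x \in S ->
  #|colinvs S m l| =
  (\sum_(c in [set c : V | - c == c])
      #|[set f in colinvs S m l | f x == (x, c)]| +
   \sum_(y in S :\ x) (#|[set f in colinvs S m l | f x == (y, 0%R)]| +
      \sum_(c | c != 0%R :> V) #|[set f in colinvs S m l | f x == (y, c)]|))%N.
Proof.
move=> xS; rewrite -sum1_card (partition_big (fun f => f x) xpredT) //=.
have -> : (\sum_(p : 'I_n * V) \sum_(f in colinvs S m l | f x == p) 1 =
           \sum_y \sum_c #|[set f in colinvs S m l | f x == (y, c)]|)%N.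
  rewrite pair_bigA; apply: eq_bigr => -[y c] _ /=.
  by rewrite -sum1_card; apply: eq_bigl => f; rewrite !inE.
have vanish y c : ~~ [&& y \in S & (y == x) ==> (- c == c)] ->
    #|[set f in colinvs S m l | f x == (y, c)]| = 0%N.
  move=> H; apply/eqP; rewrite cards_eq0; apply/eqP/setP => f; rewrite !inE.
  apply: contraNF H => /andP[/and3P[fS _ _] /eqP fx].
  have := colinv_stable fS xS; rewrite fx => -> /=; apply/implyP => /eqP yx.
  by have [/(_ x) + _] := colinvP _ _ fS; rewrite fx /= yx fx => -[_ {2}->].
rewrite (bigD1 x) //=; congr (_ + _)%N.
  rewrite [RHS]big_mkcond; apply: eq_bigr => c _; rewrite inE.
  by case: ifP => // cN; rewrite vanish // xS eqxx cN.
rewrite [LHS]big_mkcond [RHS]big_mkcond; apply: eq_bigr => y _; rewrite !inE.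
case: eqVneq => //= yx; case: ifP => yS; first by rewrite (bigD1 0).
by rewrite big1 // => c _; rewrite vanish // yS.
Qed.

(** Cleared of denominators: choose m fixed points, match the rest into l + d pairs, pick the l
    excedances among them, then colour. The induction is strong because a 2-cycle removes two
    points. *)
Lemma card_colinvs S m l d : #|S| = (m + (l + d).*2)%N ->
  (#|colinvs S m l| * (m`! * l`! * d`! * 2 ^ (l + d)) =
   #|S|`! * (t ^ m * q ^ d))%N.
Proof.
elim: {S}_.+1 {-2}S (ltnSn #|S|) m l d => // N IH S ltN m l d ES.
have [S0|[x xS]] := set_0Vmem S.
  move: ES; rewrite S0 cards0 => ES.
  have [-> -> ->] : [/\ m = 0%N, l = 0%N & d = 0%N] by split; lia.
  by rewrite colinvs_set0 cards1.
have cS1 : #|S| = #|S :\ x|.+1 by rewrite (cardsD1 x) xS.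
have cS2 y : y \in S :\ x -> #|S :\: [set x; y]| = #|S|.-2.
  by move=> yS; rewrite cS1 [X in _ = X.-1](cardsD1 y) yS setDDl.
rewrite (sum_colinvs _ _ xS) mulnDl !big_distrl /=.
pose K := (m`! * l`! * d`! * 2 ^ (l + d))%N.
rewrite -/K.
(* In [E1] and [E3] the truncated predecessors [m.-1] and [d.-1] do no harm at 0, because the
   prefactor vanishes there. *)
have E1 c : c \in [set c : V | - c == c] ->
    (#|[set f in colinvs S m l | f x == (x, c)]| * K =
     m * (#|S|.-1`! * (t ^ m.-1 * q ^ d)))%N.
  rewrite inE => /eqP cN; rewrite card_colinvs_fix // /K.
  case: (m) ES => [|m'] ES //=; rewrite factS.
  have e : #|S :\ x| = (m' + (l + d).*2)%N by lia.
  have := IH (S :\ x) _ m' l d e; rewrite {1}cS1 /= => <-; last by rewrite -ltnS -cS1.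
  by move: (#|_|) (2 ^ _)%N => A B; ring.
(* The prefactor 2l collects the factor l that l! loses and the factor 2 that the power of 2
   loses. *)
have E2 y : y \in S :\ x ->
    (#|[set f in colinvs S m l | f x == (y, 0%R)]| * K =
     l.*2 * (#|S|.-2`! * (t ^ m * q ^ d)))%N.
  move=> yS; have [yx yS'] := setD1P yS; rewrite card_colinvs_exc // /K.
  have cS := cS2 y yS.
  case: (l) ES => [|l'] ES //=; rewrite factS addSn expnS.
  have e : #|S :\: [set x; y]| = (m + (l' + d).*2)%N by lia.
  have := IH (S :\: [set x; y]) _ m l' d e; rewrite -cS => <-; last first.
    by rewrite cS cS1 (leq_ltn_trans (leq_pred _)) // -ltnS -cS1.
  by rewrite -!muln2; move: (#|_|) (2 ^ _)%N => A B; ring.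
have E3 y c : y \in S :\ x -> c != 0 ->
    (#|[set f in colinvs S m l | f x == (y, c)]| * K =
     d.*2 * (#|S|.-2`! * (t ^ m * q ^ d.-1)))%N.
  move=> yS c0; have [yx yS'] := setD1P yS; rewrite card_colinvs_nexc // /K.
  have cS := cS2 y yS; have := cardsD1 y (S :\ x); rewrite yS => cSy.
  case: (d) ES => [|d'] ES //=.
    (* For d = 0 the remaining set has only m + 2l - 2 points, too few for m fixed points and l
       excedances. *)
    by rewrite colinvs_eq0 ?cards0 // => d'; apply/eqP; lia.
  rewrite factS addnS expnS.
  have e : #|S :\: [set x; y]| = (m + (l + d').*2)%N by lia.
  have := IH (S :\: [set x; y]) _ m l d' e; rewrite -cS => <-; last first.
    by rewrite cS cS1 (leq_ltn_trans (leq_pred _)) // -ltnS -cS1.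
  by rewrite -!muln2; move: (#|_|) (2 ^ _)%N => A B; ring.
rewrite (eq_bigr _ E1) sum_nat_const -/t.
have -> : (\sum_(y in S :\ x) (#|[set f in colinvs S m l | f x == (y, 0%R)]| +
      \sum_(c | c != 0%R :> V) #|[set f in colinvs S m l | f x == (y, c)]|) * K =
   #|S|.-1 * (l.*2 * (#|S|.-2`! * (t ^ m * q ^ d)) +
              q * (d.*2 * (#|S|.-2`! * (t ^ m * q ^ d.-1)))))%N.
  rewrite {1}cS1 /= -sum_nat_const; apply: eq_bigr => y yS.
  rewrite mulnDl E2 // big_distrl /= (eq_bigr _ (fun c => E3 y c yS)).
  by rewrite sum_nat_const cardC1.
have -> : (#|S|`! = #|S| * #|S|.-1`!)%N by rewrite cS1.
have Em : (t * (m * (#|S|.-1`! * (t ^ m.-1 * q ^ d))) =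
           m * (#|S|.-1`! * (t ^ m * q ^ d)))%N.
  case: (m) => [|m'] /=; rewrite ?muln0 // expnS.
  by move: (t ^ _)%N (q ^ _)%N => A B; ring.
have Ed : (q * (d.*2 * (#|S|.-2`! * (t ^ m * q ^ d.-1))) =
           d.*2 * (#|S|.-2`! * (t ^ m * q ^ d)))%N.
  case: (d) => [|d'] /=; rewrite ?muln0 // expnS.
  by move: (t ^ _)%N (q ^ _)%N => A B; ring.
have : (0 < #|S|)%N by rewrite cS1.
rewrite Em Ed -mulnDl; case: #|S| ES => [|[|s]] //= ES _.
  (* A single point is treated apart: (s - 1)! = (s - 1) (s - 2)! fails for s = 1 under truncated
     subtraction. *)
  have [-> ->] : l = 0%N /\ d = 0%N by split; lia.
  by rewrite (_ : m = 1%N); last lia; rewrite !muln1 !mul1n addn0.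
(* The prefactors m, 2l and 2d of the three cases add up to the size of S. *)
by rewrite factS [in RHS]ES -!muln2; move: (t ^ _)%N (q ^ _)%N => A B; ring.
Qed.

End ColouredInvolutions.

(** * Self-inverse colours in Z_r *)

Lemma card_half_colours (r : nat) : (0 < r)%N ->
  #|[set c : colour r | - c == c]| = (if odd r then 1 else 2)%N.
Proof.
move=> r0.
have valE (c : colour r) : (- c == c) = ((c + c) %% r == 0)%N.
  by rewrite eq_sym -subr_eq0 opprK -(inj_eq val_inj) val_colourD.
have lt (c : colour r) : (c < r)%N by rewrite -[X in (_ < X)%N](prednK r0).
(* Since 2c < 2r, the only multiples of r that 2c can equal are 0 and r. *)
have cE (c : colour r) : (- c == c) = (c == 0) || (c.*2 == r)%N.
  have ltc := lt c; rewrite valE -(inj_eq val_inj) /= addnn.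
  case: (ltnP c.*2 r) => cr; first by rewrite modn_small //; lia.
  by rewrite -(subnK cr) modnDr modn_small; lia.
case: ifP => odr.
  rewrite -(cards1 (0 : colour r)); apply: eq_card => c; rewrite !inE cE.
  by case: eqP => //= _; apply/eqP; lia.
have hr : (r./2 < r.-1.+1)%N by lia.
rewrite (_ : [set c | _] = [set 0; Ordinal hr]).
  by rewrite cards2 -(inj_eq val_inj) /=; case: eqP => //; lia.
apply/setP => c; rewrite !inE cE; congr (_ || _).
by rewrite -(inj_eq val_inj) /=; lia.
Qed.

(** * Coloured permutations and their windows *)

Section Bijection.

Variables (r n : nat).

Definition window (sigma : {perm Sigma r n}) : {ffun 'I_n -> Sigma r n} :=
  [ffun i => sigma (uncoloured r i)].

Lemma G_windowE (sigma : {perm Sigma r n}) i c : sigma \in G r n ->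
  sigma (i, c) = ((window sigma i).1, c + (window sigma i).2).
Proof.
rewrite inE => /existsP[s /existsP[z /forallP sz]].
have E j d : sigma (j, d) = (s j, d + z j) by apply/eqP; move/forallP: (sz j).
by rewrite ffunE !E /= add0r.
Qed.

Lemma window_inj : {in G r n &, injective window}.
Proof.
by move=> s t sG tG E; apply/permP => -[i c]; rewrite !G_windowE // E.
Qed.

Lemma colinv_window sigma : sigma \in G r n ->
  colinv [set: 'I_n] (window sigma) = involutive_perm sigma.
Proof.
move=> sG; apply/colinvP/eqP => [[wK _]|s1].
  apply/permP => -[i c]; rewrite expgS expg1 permM perm1 !G_windowE //= wK /=.
  by rewrite addrK.
split=> [i|i]; last by rewrite inE.
(* The colour is chosen so that the inner image is uncoloured, and the outer application then reads
   off a window value. *)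
have: sigma (sigma (i, - (window sigma i).2)) = (i, - (window sigma i).2).
  by rewrite -permM [(_ * _)%g]s1 perm1.
by rewrite [sigma (i, _)]G_windowE // addNr => <-; rewrite ffunE.
Qed.

(** Both the map on coloured points built from f and its underlying map on ['I_n] are involutions,
    hence permutations. *)
Lemma colinv_of_window f : colinv [set: 'I_n] f ->
  exists2 sigma, sigma \in G r n & f = window sigma.
Proof.
case/colinvP => fK _.
have sK : involutive (fun x : Sigma r n => ((f x.1).1, x.2 + (f x.1).2)).
  by move=> -[i c] /=; rewrite fK /= addrK.
have s1K : involutive (fun i => (f i).1) by move=> i; rewrite fK.
exists (perm (inv_inj sK)).
  rewrite inE; apply/existsP; exists (perm (inv_inj s1K)).
  apply/existsP; exists [ffun i => (f i).2].
  by apply/forallP => i; apply/forallP => c; rewrite !permE ffunE.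
by apply/ffunP => i; rewrite !ffunE permE /= add0r; case: (f i).
Qed.

(** The restriction to i in [n-1] is automatic, as the last point has no larger uncoloured point
    above it. *)
Lemma excA_window sigma : excA sigma = exc (window sigma).
Proof.
apply: eq_card => i; rewrite !inE ffunE /colour_lt /=.
case: (sigma _) => j c /=; rewrite [0 == _]eq_sym -(inj_eq val_inj c 0) /=.
case: (val c == 0%N); rewrite ?andbF //=.
by rewrite andbT; have := ltn_ord j; lia.
Qed.

Lemma card_G_colinvs m l :
  #|[set sigma in G r n | [&& involutive_perm sigma,
       #|absfix sigma| == m & excA sigma == l]]| =
  #|colinvs (colour r) [set: 'I_n] m l|.
Proof.
have fixE sigma : #|absfix sigma| = fixedin [set: 'I_n] (window sigma).
  by apply: eq_card => i; rewrite !inE ffunE.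
rewrite -(card_in_imset (f := window)); last first.
  by move=> s t /setIdP[sG _] /setIdP[tG _]; apply: window_inj.
apply: eq_card => f; apply/imsetP/idP => [[s /setIdP[sG H] ->]|].
  by rewrite inE colinv_window // -fixE -excA_window.
rewrite inE => /and3P[fI fm fl]; have [s sG E] := colinv_of_window fI.
exists s => //; apply/setIdP; split=> //.
by rewrite -colinv_window // fixE excA_window -E fI fm.
Qed.

End Bijection.

(* If the multinomial coefficient is nonzero, the arguments of Num.truncn and
   Num.floor are integers; if it is 0, the whole product is 0. *)
Theorem corollary5p3 (r n m l k : nat) (hr : (1 <= r)%N) (hn : (1 <= n)%N)
    (hk : (k < 2)%N) (hkr : k = r %[mod 2]) :
  let h : rat := (n%:R - m%:R) / 2 in
  #|[set sigma in G r n | [&& involutive_perm sigma,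
       #|absfix sigma| == m & excA sigma == l]]|%:R =
  (Num.truncn h)`!%:R
  * (r%:R - 1) ^ Num.floor (h - l%:R)
  * multinomial n [:: h; m%:R; h - l%:R; l%:R]
  * 2 ^ Num.floor ((m%:R * (3 - 2 * k%:R) - n%:R) / 2 : rat).
Proof.
move=> h; rewrite card_G_colinvs.
(* Either n = m + 2(l + d) for some d, necessarily at most n, or both sides are 0. *)
have [/exists_eqP /= [[d _] /= nE]|noE] :=
    boolP [exists d : 'I_n.+1, n == (m + (l + d).*2)%N]; last first.
  rewrite colinvs_eq0 ?cards0 => [|d]; last first.
    rewrite cardsT card_ord; apply: contra noE => /eqP E.
    have lt : (d < n.+1)%N by lia.
    by apply/existsP; exists (Ordinal lt); apply/eqP.
  rewrite /multinomial; case: ifP; last by rewrite mulr0 mul0r.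
  (* If the entry h - l is a natural number d, then n = m + 2(l + d), contrary to assumption. *)
  case/and4P=> [/natrP[a ha] _ /natrP[d hd] _].
  have E : n = (m + (l + d).*2)%N.
    apply/eqP; rewrite -(eqr_nat rat) -muln2 !(natrD, natrM) -hd /h.
    by apply/eqP; field.
  have lt : (d < n.+1)%N by lia.
  by case/existsP: noE; exists (Ordinal lt); apply/eqP.
have hE : h = (l + d)%:R.
  by rewrite /h {1}nE -muln2 !(natrD, natrM); field.
have hlE : h - l%:R = d%:R by rewrite hE natrD addrAC subrr add0r.
have := @card_colinvs n (colour r) [set: 'I_n] m l d.
rewrite cardsT card_ord => /(_ nE); rewrite card_half_colours // card_ord /=.
move=> C.
(* Substituting n = m + 2(l + d) gives the integer exponent m(1 - k) - (l + d): the first term comes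
   from the self-inverse colours, the second from the unordered pairs. *)
have -> : (m%:R * (3 - 2 * k%:R) - n%:R) / 2 =
    ((m * (1 - k))%N%:Z - (l + d)%N%:Z)%:~R :> rat.
  rewrite nE -muln2 rmorphB /= -!pmulrn natrM natrB; last by lia.
  by rewrite !(natrD, natrM); field.
have fK (z : int) : Num.floor (z%:~R : rat) = z := intrKfloor z.
rewrite fK hlE hE natrK (fK d) expfzDr // -exprnN -!exprnP.
rewrite /multinomial /= !natr_nat /=.
rewrite !big_cons big_nil !natrK mulr1.
have -> : r%:R - 1 = r.-1%:R :> rat by rewrite -{1}(prednK hr) -natr1 addrK.
have tE : ((if odd r then 1 else 2) ^ m = 2 ^ (m * (1 - k)))%N.
  rewrite mulnC expnM; congr (_ ^ _)%N.
  have -> : k = odd r by rewrite -modn2 -hkr modn_small.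
  by case: (odd r).
move: C => /(congr1 (fun x => x%:R : rat)); rewrite tE !(natrM, natrX) => C.
have fact0 p : p`!%:R != 0 :> rat by rewrite pnatr_eq0 -lt0n fact_gt0.
have pow0 : 2 ^+ (l + d) != 0 :> rat by rewrite expf_neq0.
(* Multiplying by the denominator of the count makes [C] applicable; the leading (l + d)! cancels
   against the entry h of the multinomial. *)
apply: (mulIf (x := m`!%:R * l`!%:R * d`!%:R * 2 ^+ (l + d))).
  by rewrite !mulf_neq0.
rewrite C; field.
by rewrite pow0 !fact0.
Qed.
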